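(* $|\mathsf{PTAB}(\mathsf{S4}_t)|\geq|\mathsf{PTAB}(\mathsf{S4BP}^{2,\omega}_{2,3})|=2^{\aleph_0}$.
   Context: Tense formulas are built from propositional variables, $\bot$, $\to$, a future necessity $\Box$ and a past possibility operator, written here $\mathsf{P}$ ($\mathsf{P}\phi$ holds at $x$ iff $\phi$ holds at some $R$-predecessor of $x$); $\Diamond=\neg\Box\neg$. A normal tense logic contains classical tautologies, is closed under modus ponens and substitution, and satisfies $\mathsf{P}\phi\to\psi\in L$ iff $\phi\to\Box\psi\in L$; $\mathsf{S4}_t=\mathsf{K}_t\oplus\{\Box p\to p,\Box p\to\Box\Box p\}$. A logic is tabular if it is the logic of a finite frame, pretabular if it is non-tabular and all its consistent proper extensions are tabular; $\mathsf{PTAB}(L)$ is the set of pretabular logics extending $L$. Let $\Delta\phi=\phi\vee\Diamond\phi\vee\mathsf{P}\phi$, $\Delta^{n+1}\phi=\Delta\Delta^n\phi$. For $n\in\mathbb{Z}^+$ let $\mathbf{bz}_n=\Delta^{n+1}p\to\Delta^np$; $\mathbf{bw}^+_n=\bigwedge_{i\leq n}\Diamond p_i\to\bigvee_{i\neq j\leq n}\Diamond(p_i\wedge(p_j\vee\Diamond p_j))$; $\mathbf{bw}^-_n$ the same with $\mathsf{P}$ in place of $\Diamond$; $\mathbf{bd}_1=\Diamond\Box p_0\to p_0$, $\mathbf{bd}_{k+1}=\Diamond(\Box p_k\wedge\neg\mathbf{bd}_k)\to p_k$; and $\mathbf{bd}_\omega=\mathbf{bz}_\omega=\mathbf{bw}^\pm_\omega=\top$.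 Then $\mathsf{S4BP}^{k,l}_{n,m}=\mathsf{S4}_t\oplus\{\mathbf{bd}_k,\mathbf{bz}_l,\mathbf{bw}^+_n,\mathbf{bw}^-_m\}$ (frames of depth $\le k$, z-degree $\le l$, forth-width $\le n$, back-width $\le m$). *)

(* Defs.v *)
From mathcomp Require Import all_boot.
From mathcomp Require Import classical_sets cardinality.

Set Implicit Arguments.
Unset Strict Implicit.
Unset Printing Implicit Defensive.

Local Open Scope classical_set_scope.

Inductive form : Type :=
  | Var of nat
  | Bot
  | Imp of form & form
  | Box of form
  | Past of form.

Definition Neg (a : form) : form := Imp a Bot.
Definition Top : form := Neg Bot.
Definition Or (a b : form) : form := Imp (Neg a) b.
Definition And (a b : form) : form := Neg (Imp a (Neg b)).
Definition Dia (a : form) : form := Neg (Box (Neg a)).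

Definition bigAnd (s : seq form) : form := foldr And Top s.
Definition bigOr (s : seq form) : form := foldr Or Bot s.

Fixpoint subst (s : nat -> form) (a : form) : form :=
  match a with
  | Var i => s i
  | Bot => Bot
  | Imp b c => Imp (subst s b) (subst s c)
  | Box b => Box (subst s b)
  | Past b => Past (subst s b)
  end.

(* Variables and modal formulas are treated as propositional atoms, so
   [tautology] covers all tense instances of classical tautologies. *)
Fixpoint bool_eval (v : form -> bool) (a : form) : bool :=
  match a with
  | Bot => false
  | Imp b c => bool_eval v b ==> bool_eval v c
  | _ => v a
  end.

Definition tautology (a : form) : Prop := forall v, bool_eval v a.

(* The [adjoint] condition yields necessitation and the K axiom for [Box],
   as well as the corresponding principles for [Past]. *)
Record normal_tense_logic (L : set form) : Prop := NormalTenseLogic {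
  ntl_taut : forall a, tautology a -> L a;
  ntl_mp : forall a b, L (Imp a b) -> L a -> L b;
  ntl_subst : forall s a, L a -> L (subst s a);
  ntl_adjoint : forall a b, L (Imp (Past a) b) <-> L (Imp a (Box b)) }.

Definition oplus (L S : set form) : set form :=
  smallest normal_tense_logic (L `|` S).

Definition Kt : set form := smallest normal_tense_logic set0.

Definition S4t : set form :=
  oplus Kt [set Imp (Box (Var 0)) (Var 0);
                Imp (Box (Var 0)) (Box (Box (Var 0)))].

Record frame : Type := Frame {
  world :> Type;
  world_nonempty : inhabited world;
  acc : world -> world -> Prop }.

Fixpoint sat (F : frame) (V : nat -> set F) (x : F) (a : form) : Prop :=
  match a with
  | Var i => V i x
  | Bot => False
  | Imp b c => sat V x b -> sat V x c
  | Box b => forall y, acc x y -> sat V y b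
  | Past b => exists2 y, acc y x & sat V y b
  end.

Definition logic_of (F : frame) : set form :=
  [set a | forall (V : nat -> set F) (x : F), sat V x a].

Definition tabular (L : set form) : Prop :=
  exists2 F : frame, finite_set [set: F] & L = logic_of F.

Definition consistent (L : set form) : Prop := ~ L Bot.

(* As frames are nonempty, the inconsistent logic is non-tabular and satisfies
   [pretabular] vacuously; it adds one element to each [PTAB L]. *)
Definition pretabular (L : set form) : Prop :=
  ~ tabular L /\
  forall L' : set form, normal_tense_logic L' -> proper L L' ->
    consistent L' -> tabular L'.

Definition PTAB (L : set form) : set (set form) :=
  [set L' | [/\ normal_tense_logic L', L `<=` L' & pretabular L']].

(* Parameters range over the positive integers together with omega; the value
   [Fin 0] is not used. *)
Inductive bound : Type := Fin of nat | Omega.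

Definition bounded (f : nat -> form) (k : bound) : form :=
  if k is Fin n then f n else Top.

Definition Delta (a : form) : form := Or a (Or (Dia a) (Past a)).

Definition bz (n : nat) : form :=
  Imp (iter n.+1 Delta (Var 0)) (iter n Delta (Var 0)).

(* [bw Dia n] and [bw Past n] are the forth-width and back-width axioms; the
   indices i, j <= n range over n.+1 variables. *)
Definition bw (M : form -> form) (n : nat) : form :=
  Imp (bigAnd [seq M (Var i) | i <- iota 0 n.+1])
      (bigOr [seq M (And (Var i) (Or (Var j) (M (Var j))))
             | i <- iota 0 n.+1, j <- [seq j <- iota 0 n.+1 | j != i]]).

Fixpoint bd (k : nat) : form :=
  match k with
  | 0 => Bot
  | 1 => Imp (Dia (Box (Var 0))) (Var 0)
  | k'.+1 => Imp (Dia (And (Box (Var k')) (Neg (bd k')))) (Var k')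
  end.

Definition S4BP (k l n m : bound) : set form :=
  oplus S4t [set bounded bd k; bounded bz l;
                 bounded (bw Dia) n; bounded (bw Past) m].

(* Main.v *)
(* Let [word x] be the sequence n |-> x' (v_2 (n + 1)), where x' is x interleaved
   with zeros, and let [comb_frame (word x)] be the infinite zigzag whose n-th
   peak carries a pendant iff [word x n].  Windows of length 2^K of [word x]
   contain a number of ones determined up to 1 by the first K values of x', so
   for x <> y all sufficiently long windows of [word x] differ from those of
   [word y].

   By Zorn's lemma the logic of [comb_frame (word x)] extends to a logic L_x
   maximal among the normal logics containing no bz_n.  In the canonical model
   of an extension of this logic every point has at most four neighbours; with
   bz_n the components have bounded size, so a consistent proper extension of
   L_x is tabular, and L_x is pretabular.

   If L_x = L_y with x <> y, the absence of the bz_n gives arbitrarily long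
   geodesics in the canonical model.  Since the model is locally finite and
   differentiated, a characteristic formula lifts such a geodesic to a straight
   path both in [comb_frame (word x)] and in [comb_frame (word y)].  Whether a peak
   carries a pendant can be read off in the canonical model as having three proper
   predecessors, so the same pattern is a long window of both words. *)

From HB Require Import structures.
Require Import Defs.
From mathcomp Require Import all_boot.
From mathcomp Require Import boolp classical_sets cardinality.
From mathcomp Require Import zify.

Set Implicit Arguments.
Unset Strict Implicit.
Unset Printing Implicit Defensive.

Local Open Scope classical_set_scope.
Local Open Scope card_scope.

(** * Countability of the set of formulas *)

Fixpoint form_code (a : form) : GenTree.tree nat :=
  match a with
  | Var i => GenTree.Leaf i
  | Bot => GenTree.Node 0 [::]
  | Imp b c => GenTree.Node 1 [:: form_code b; form_code c]
  | Box b => GenTree.Node 2 [:: form_code b]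
  | Past b => GenTree.Node 3 [:: form_code b]
  end.

Fixpoint form_decode (t : GenTree.tree nat) : form :=
  match t with
  | GenTree.Leaf i => Var i
  | GenTree.Node 1 [:: s; t] => Imp (form_decode s) (form_decode t)
  | GenTree.Node 2 [:: s] => Box (form_decode s)
  | GenTree.Node 3 [:: s] => Past (form_decode s)
  | _ => Bot
  end.

Lemma form_codeK : cancel form_code form_decode.
Proof. by elim=> //= [a -> b ->|a ->|a ->]. Qed.

HB.instance Definition _ := Countable.copy form (can_type form_codeK).

(** Classical equality and choice on worlds allow finite sets of worlds to be handled as lists. *)
HB.instance Definition _ (F : frame) := gen_eqMixin (world F).
HB.instance Definition _ (F : frame) := gen_choiceMixin (world F).

(** [Zorn_bigcup] also asks for the empty chain; working with the sets whose union with [X]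
    satisfies [P] turns that case into [P X]. *)
Lemma Zorn_above (T : Type) (P : set (set T)) (X : set T) :
  P X ->
  (forall C : set (set T), C !=set0 -> C `<=` P -> total_on C subset ->
     P (\bigcup_(A in C) A)) ->
  exists A, [/\ X `<=` A, P A & forall B, A `<` B -> ~ P B].
Proof.
move=> PX Pchain; have [C Cp Ctot|A [PA Amax]] :=
    @Zorn_bigcup T [set A | P (X `|` A)].
  have [C0|/set0P Cn0] := eqVneq C set0.
    by rewrite C0 bigcup_set0 /= setU0.
  rewrite /= (_ : X `|` _ =
              \bigcup_(B in [set X `|` A | A in C]) B); last first.
    rewrite bigcup_image; apply/seteqP; split=> [x [Xx|[A CA Ax]]|x].
    - by have [A CA] := Cn0; exists A => //; left.
    - by exists A => //; right.
    - by move=> [A CA [Xx|Ax]]; [left|right; exists A].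
  apply: Pchain.
  - by have [A CA] := Cn0; exists (X `|` A), A.
  - by move=> _ [A CA <-]; exact: Cp.
  - move=> _ _ [A CA <-] [B CB <-].
    by have [AB|BA] := Ctot _ _ CA CB; [left|right]; exact: setUS.
exists (X `|` A); split=> // B [AB BA] PB.
have XB : X `|` B = B by apply/setUidPr => x Xx; apply: AB; left.
apply: (Amax B); last by rewrite /= XB.
by split=> [x Ax|BA']; [apply: AB; right|apply: BA => x /BA'; right].
Qed.

(** * Truth-functional sets of formulas and satisfaction in models *)

(** These are the maximal consistent sets of propositional logic with modal formulas as atoms;
    canonical points and the sets [th V x] are both of this kind. *)
Definition hom (u : set form) : Prop :=
  ~ u Bot /\ forall a b, u (Imp a b) <-> (u a -> u b).

Section Hom.
Variables (u : set form) (hu : hom u).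

Lemma homB : ~ u Bot. Proof. by case: hu. Qed.

Lemma homI a b : u (Imp a b) <-> (u a -> u b). Proof. by case: hu. Qed.

Lemma homN a : u (Neg a) <-> ~ u a.
Proof. by rewrite homI; split=> // + ua => /(_ ua)/homB. Qed.

Lemma homO a b : u (Or a b) <-> u a \/ u b.
Proof.
rewrite homI homN; split=> [|[ua|//] []//].
by have [ua|nua] := pselect (u a); [left|right; auto].
Qed.

Lemma homA a b : u (And a b) <-> u a /\ u b.
Proof.
rewrite homN homI homN; split=> [h|[ua ub] h]; last exact: h.
by split; apply: contrapT => n; apply: h => // /n.
Qed.

Lemma homT : u Top. Proof. by apply/homN/homB. Qed.

Lemma homAs s : u (bigAnd s) <-> forall a, a \in s -> u a.
Proof.
elim: s => /= [|a s IH]; first by split=> // _; exact: homT.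
rewrite homA IH; split=> [[ua us] b|us]; first by rewrite inE => /predU1P[->|/us].
by split=> [|b bs]; apply: us; rewrite inE ?eqxx ?bs ?orbT.
Qed.

Lemma homOs s : u (bigOr s) <-> exists2 a, a \in s & u a.
Proof.
elim: s => /= [|a s IH]; first by split=> [/homB|[]].
rewrite homO IH; split=> [[ua|[b bs ub]]|[b]].
- by exists a => //; rewrite inE eqxx.
- by exists b => //; rewrite inE bs orbT.
- by rewrite inE => /predU1P[->|bs]; [left|right; exists b].
Qed.

Lemma hom_taut a : tautology a -> u a.
Proof.
move=> /(_ (fun b => `[<u b>])).
suff -> : bool_eval (fun b => `[<u b>]) a = `[<u a>] by move/asboolP.
elim: a => //= [|a IHa b IHb].
  by apply/esym/negbTE/asboolP; exact: homB.
rewrite IHa IHb; apply/implyP/asboolP; first by move=> h; apply/homI=> /asboolP/h/asboolP.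
by move=> /homI h /asboolP/h/asboolP.
Qed.

End Hom.

Definition th (F : frame) (V : nat -> set F) (x : F) : set form :=
  [set a | sat V x a].

Lemma th_hom (F : frame) (V : nat -> set F) (x : F) : hom (th V x).
Proof. by split=> [[]|a b]; split. Qed.

Lemma satN (F : frame) V (x : F) a : sat V x (Neg a) <-> ~ sat V x a.
Proof. by []. Qed.

Lemma satO (F : frame) V (x : F) a b :
  sat V x (Or a b) <-> sat V x a \/ sat V x b.
Proof. exact: (homO (th_hom V x)). Qed.

Lemma satA (F : frame) V (x : F) a b :
  sat V x (And a b) <-> sat V x a /\ sat V x b.
Proof. exact: (homA (th_hom V x)). Qed.

Lemma satAs (F : frame) V (x : F) s :
  sat V x (bigAnd s) <-> forall a, a \in s -> sat V x a.
Proof. exact: (homAs (th_hom V x)). Qed.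

Lemma satOs (F : frame) V (x : F) s :
  sat V x (bigOr s) <-> exists2 a, a \in s & sat V x a.
Proof. exact: (homOs (th_hom V x)). Qed.

Lemma satD (F : frame) V (x : F) a :
  sat V x (Dia a) <-> exists2 y, acc x y & sat V y a.
Proof.
split=> [/= h|[y xy ya] h]; last exact: h xy ya.
by apply: contrapT => h'; apply: h => y xy ya; apply: h'; exists y.
Qed.

Lemma sat_subst (F : frame) V s (x : F) a :
  sat V x (subst s a) <-> sat (fun i y => sat V y (s i)) x a.
Proof.
elim: a x => //= [a IHa b IHb|a IHa|a IHa] x.
- by rewrite IHa IHb.
- by split=> h y /h /IHa.
- by split=> -[y ? /IHa ?]; exists y.
Qed.

Lemma logic_of_normal (F : frame) : normal_tense_logic (logic_of F).
Proof.
split=> [a ta V x|a b ab aa V x|s a aa V x|a b].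
- exact: (hom_taut (th_hom V x)).
- exact: ab (aa V x).
- by apply/sat_subst; exact: aa.
- split=> ab V x /=; first by move=> ax y xy; apply: ab; exists x.
  by move=> [y yx /ab]; exact.
Qed.

Ltac taut := let v := fresh "v" in move=> v /=;
  repeat match goal with |- context [bool_eval v ?a] =>
    case: (bool_eval v a) | |- context [v ?a] => case: (v a) end; done.

(** * The canonical model *)

Definition theory (T : set form) : Prop :=
  (forall a, tautology a -> T a) /\ forall a b, T (Imp a b) -> T a -> T b.

(** Lindenbaum's lemma: a theory maximal among those omitting [e] is truth-functional. *)
Lemma theory_hom_ext (T : set form) (e : form) :
  theory T -> ~ T e -> exists u, [/\ hom u, T `<=` u & ~ u e].
Proof.
move=> thT nTe.
have [||A [TA [[At Amp] nAe] Amax]] :=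
    @Zorn_above _ [set A | theory A /\ ~ A e] T; first by [].
  move=> C [A CA] CP Ctot; split; last by move=> [B /CP[_]].
  split=> [a ta|a b [B CB Bab] [B' CB' Ba]].
    by exists A => //; have [[+ _] _] := CP _ CA; apply.
  have [BB'|BB'] := Ctot _ _ CB CB'.
    by exists B' => //; have [[_ mp] _] := CP _ CB'; apply: mp Ba; exact: BB'.
  by exists B => //; have [[_ mp] _] := CP _ CB; apply: mp Bab _; exact: BB'.
(* The formulas implied by [a] over [A] form a theory properly extending [A]; by maximality it
   contains [e]. *)
have AIe a : ~ A a -> A (Imp a e).
  move=> nAa; apply: contrapT => nae; apply: (Amax [set b | A (Imp a b)]).
    split=> [b Ab /=|/(_ a) AB].
      by apply: Amp Ab; apply: At; taut.
    by apply: nAa; apply: AB; apply: At; taut.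
  split=> //; split=> [b tb|b c Aabc Aab] /=.
    by apply: At => v /=; rewrite (tb v) implybT.
  apply: (Amp _ _ (Amp _ _ _ Aabc) Aab); apply: At; taut.
exists A; split=> //; split=> [AB|a b].
  by apply: nAe; apply: Amp AB; apply: At => v.
split=> [|ab]; first exact: Amp.
have [Aa|nAa] := pselect (A a).
  apply: Amp (ab Aa); apply: At; taut.
apply: contrapT => /AIe abe; apply: nAe.
apply: (Amp _ _ (Amp _ _ _ (AIe _ nAa)) abe); apply: At; taut.
Qed.

Section NormalLogic.
Variables (L : set form) (nL : normal_tense_logic L).

Lemma ntl_theory : theory L.
Proof. by split; [exact: ntl_taut|exact: ntl_mp]. Qed.

Definition cpoint (u : set form) : Prop := hom u /\ L `<=` u.

Definition crel (u v : set form) : Prop := forall a, u (Box a) -> v a.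

Lemma ntl_nec a : L a -> L (Box a).
Proof.
move=> La; have /(ntl_adjoint nL) TBa : L (Imp (Past Top) a).
  by apply: ntl_mp La => //; apply: ntl_taut => //; taut.
by apply: (ntl_mp nL TBa); apply: ntl_taut.
Qed.

Lemma ntl_sem a : (forall u, cpoint u -> u a) -> L a.
Proof.
move=> h; apply: contrapT => /(theory_hom_ext ntl_theory)[u [hu Lu nua]].
by apply: nua; apply: h.
Qed.

(** Counit of the adjunction between [Past] and [Box]; [cpoint_box_past] is the unit. *)
Lemma cpoint_past_box u a : cpoint u -> u (Past (Box a)) -> u a.
Proof.
move=> [hu Lu]; apply/(homI hu)/Lu/(ntl_adjoint nL).
by apply: ntl_taut => //; taut.
Qed.

Lemma cpoint_box_past u a : cpoint u -> u a -> u (Box (Past a)).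
Proof.
move=> [hu Lu]; apply/(homI hu)/Lu/(ntl_adjoint nL).
by apply: ntl_taut => //; taut.
Qed.

Lemma past_mono a b : (forall u, cpoint u -> u a -> u b) ->
  forall u, cpoint u -> u (Past a) -> u (Past b).
Proof.
move=> ab u [hu Lu]; apply/(homI hu)/Lu/(ntl_adjoint nL)/ntl_sem => v cv.
by apply/(homI cv.1) => /(ab _ cv); exact: cpoint_box_past.
Qed.

Lemma box_mono a b : (forall u, cpoint u -> u a -> u b) ->
  forall u, cpoint u -> u (Box a) -> u (Box b).
Proof.
move=> ab u [hu Lu]; apply/(homI hu)/Lu/(ntl_adjoint nL)/ntl_sem => v cv.
by apply/(homI cv.1) => /(cpoint_past_box cv)/(ab _ cv).
Qed.

Lemma box_mp u a b : cpoint u -> u (Box (Imp a b)) -> u (Box a) -> u (Box b).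
Proof.
move=> cu uab ua; have [hu Lu] := cu.
suff /Lu/(homI hu) : L (Imp (And (Box (Imp a b)) (Box a)) (Box b)).
  by apply; apply/homA.
apply/(ntl_adjoint nL)/ntl_sem => v cv; apply/(homI cv.1) => vP.
have : v (Imp a b) by apply: cpoint_past_box => //; apply: past_mono vP => //
  w cw /(homA cw.1)[].
move/(homI cv.1); apply; apply: cpoint_past_box => //.
by apply: past_mono vP => // w cw /(homA cw.1)[].
Qed.

Lemma crel_past u v a : cpoint u -> cpoint v -> crel v u -> v a -> u (Past a).
Proof. by move=> cu cv vu /(cpoint_box_past cv)/vu. Qed.

Lemma box_ex u b : cpoint u ->
  u (Box b) <-> forall v, cpoint v -> crel u v -> v b.
Proof.
move=> cu; split=> [ub v _|h]; first exact.
apply: contrapT => nub; have [||v [hv Lv nvb]] :=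
    @theory_hom_ext [set a | u (Box a)] b; [|exact: nub|].
  split=> [a ta|a c]; last exact: box_mp.
  by apply: cu.2; apply: ntl_nec; exact: ntl_taut.
apply: nvb; apply: h => //; split=> // a La.
by apply: Lv; apply: cu.2; exact: ntl_nec.
Qed.

(** Since [crel] is defined from [Box] alone, this direction needs the adjunction. The witness
    contains [b] and every formula that, according to [u], holds at all predecessors. *)
Lemma past_ex u b : cpoint u ->
  u (Past b) <-> exists2 v, cpoint v & crel v u /\ v b.
Proof.
move=> cu; have [hu Lu] := cu.
split=> [ub|[v cv [vu vb]]]; last exact: crel_past vb.
have PnL a : L a -> ~ u (Past (Neg a)).
  move=> La uP; apply: (homB hu); apply: cpoint_past_box => //.
  by apply: past_mono uP => // v cv /(homN cv.1)[]; exact: cv.2.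
have [||v [hv Lv nvb]] :=
    @theory_hom_ext [set a | ~ u (Past (Neg a))] (Neg b).
- split=> [a ta|a c /= ac na uc]; first by apply: PnL; exact: ntl_taut.
  (* [Past] distributes over disjunction: each [w] refuting [c] refutes [a] or [Imp a c], the unit
     puts the disjunction under [Box] at [w], and the counit returns it to [u]. *)
  have [] : u (Past (Neg a)) \/ u (Past (Neg (Imp a c))); last 2 first.
  + exact: na.
  + exact: ac.
  apply/(homO hu); apply: cpoint_past_box => //.
  apply: past_mono uc => // w cw /(homN cw.1) nwc.
  have [wa|nwa] := pselect (w a).
    apply: (box_mono (a := Past (Neg (Imp a c)))) => //.
      by move=> z cz zP; apply/(homO cz.1); right.
    by apply: cpoint_box_past => //; apply/(homN cw.1)/(homI cw.1) => /(_ wa).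
  apply: (box_mono (a := Past (Neg a))) => //.
    by move=> z cz zP; apply/(homO cz.1); left.
  by apply: cpoint_box_past => //; apply/(homN cw.1).
- move=> /=; apply; apply: past_mono ub => // v cv vb.
  by apply/(homN cv.1) => /(homN cv.1).
have cv : cpoint v by split=> // a /PnL; exact: Lv.
exists v => //; split; last by apply: contrapT => /(homN hv).
move=> a vBa; apply: contrapT => nua.
have /Lv/(homN hv) : ~ u (Past (Neg (Neg (Box a)))); last exact.
move=> uP; apply: nua; apply: cpoint_past_box => //.
by apply: past_mono uP => // w cw /(homN cw.1)/(homN cw.1)/contrapT.
Qed.

End NormalLogic.

Definition differentiated (F : frame) (V : nat -> set F) : Prop :=
  forall x y : F, x <> y -> exists a, sat V x a /\ ~ sat V y a.

Lemma canonical_model (L : set form) : normal_tense_logic L -> consistent L ->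
  exists (G : frame) (V : nat -> set G),
    differentiated V /\ forall a, L a <-> forall x, sat V x a.
Proof.
move=> nL cL; have [w [hw Lw _]] := theory_hom_ext (ntl_theory nL) cL.
pose G := @Frame {u : set form | cpoint L u} (inhabits (exist _ w (conj hw Lw)))
  (fun u v => crel (sval u) (sval v)).
pose V i : set G := [set u | sval u (Var i)].
have truth a (u : G) : sat V u a <-> sval u a.
  elim: a u => [//||a IHa b IHb|a IHa|a IHa] [u cu] /=.
  - by split=> // /(homB cu.1).
  - by rewrite IHa IHb; split=> /(homI cu.1).
  - rewrite (box_ex nL _ cu); split=> [h v cv uv|h [v cv] uv].
      exact/(IHa (exist _ v cv))/h.
    by apply/(IHa (exist _ v cv)); apply: h.
  - rewrite (past_ex nL _ cu); split=> [[[v cv] vu /IHa]|[v cv [vu va]]].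
      by exists v.
    by exists (exist _ v cv) => //; apply/IHa.
exists G, V; split=> [x y xy|a].
  apply: contrapT => h; apply: xy; case: x y h => [u cu] [v cv] h.
  suff E : u = v by subst v; congr exist; exact: Prop_irrelevance.
  apply/seteqP; split=> a.
    move=> ua; apply: contrapT => nva; apply: h; exists a.
    by split; [apply/truth|move/truth].
  move=> va; apply: contrapT => nua; apply: h; exists (Neg a).
  by split; [move=> /truth|apply; apply/truth].
split=> [La [u cu]|h]; first by apply/truth; exact: cu.2.
by apply: (ntl_sem nL) => u cu; apply/(truth _ (exist _ u cu)).
Qed.

(** * Finitely branching differentiated models *)

(** [Delta] is the possibility operator of this relation; by reflexivity, [reach n] means at most
    [n] zigzag steps. *)
Definition near (F : frame) (x y : F) : Prop := [\/ x = y, acc x y | acc y x].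

Fixpoint reach (F : frame) (n : nat) (x y : F) : Prop :=
  if n is m.+1 then exists2 z, near x z & reach m z y else x = y.

Section Reach.
Variable F : frame.
Implicit Types x y z : F.

Lemma near_refl x : near x x. Proof. by apply: Or31. Qed.

Lemma reach_add n m x y z : reach n x y -> reach m y z -> reach (n + m) x z.
Proof.
elim: n x => [x -> //|n IH x [w xw wy] yz]; exists w => //; exact: IH.
Qed.

Lemma reach1 x y : near x y -> reach 1 x y. Proof. by exists y. Qed.

Lemma reach_refl n x : reach n x x.
Proof. by elim: n => // n IH; exists x => //; exact: near_refl. Qed.

Lemma reach_mono n m x y : n <= m -> reach n x y -> reach m x y.
Proof. by move=> nm xy; rewrite -(subnKC nm); apply: reach_add xy (reach_refl _ _). Qed.

Lemma reach_rcons n x y z : reach n x y -> near y z -> reach n.+1 x z.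
Proof. by move=> xy yz; rewrite -addn1; apply: reach_add xy (reach1 yz). Qed.

Lemma reach_path n x y : reach n x y ->
  exists g, [/\ g 0 = x, g n = y & forall i, i < n -> near (g i) (g i.+1)].
Proof.
elim: n x => [x ->|n IH x [z xz /IH[g [g0 gn gi]]]]; first by exists (fun=> y).
by exists (fun i => if i is j.+1 then g j else x); split=> // -[_|i /gi//]; rewrite g0.
Qed.

Lemma path_reach (g : nat -> F) n : (forall i, i < n -> near (g i) (g i.+1)) ->
  forall i k, i + k <= n -> reach k (g i) (g (i + k)).
Proof.
move=> gn i k; elim: k i => [|k IH] i ik; first by rewrite addn0.
by exists (g i.+1); [apply: gn; lia|rewrite -addSnnS; apply: IH; lia].
Qed.

Lemma sat_Delta V x a : sat V x (Delta a) <-> exists2 y, near x y & sat V y a.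
Proof.
rewrite /Delta !satO satD; split.
  move=> [xa|[[y xy ya]|[y yx ya]]]; first by exists x => //; apply: Or31.
    by exists y => //; apply: Or32.
  by exists y => //; apply: Or33.
move=> [y [->|xy|yx] ya]; first by left.
  by right; left; exists y.
by right; right; exists y.
Qed.

Lemma sat_iter_Delta V n x a :
  sat V x (iter n Delta a) <-> exists2 y, reach n x y & sat V y a.
Proof.
elim: n x => [|n IH] x; first by split=> [xa|[y -> //]]; exists x.
rewrite iterS sat_Delta; split=> [[z xz /IH[y zy ya]]|[y [z xz zy] ya]].
  by exists y => //; exists z.
by exists z => //; apply/IH; exists y.
Qed.

End Reach.

Lemma subst_iter_Delta s n a :
  subst s (iter n Delta a) = iter n Delta (subst s a).
Proof. by elim: n => //= n ->. Qed.

Definition near_bounded (K : nat) (F : frame) : Prop :=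
  forall x : F, exists2 s : seq F, size s <= K & forall y, near x y -> y \in s.

Lemma reach_bounded K (F : frame) : near_bounded K F -> forall n (x : F),
  exists s : seq F, [/\ uniq s, size s <= K ^ n & forall y, reach n x y -> y \in s].
Proof.
move=> bF; have /choice[N NP] (x : F) : exists s : seq F,
    size s <= K /\ forall y, near x y -> y \in s.
  by have [s] := bF x; exists s.
elim=> [|n IH] x; first by exists [:: x]; split=> // y /= ->; rewrite inE.
have [s [us ss sP]] := IH x.
exists (undup (flatten [seq N y | y <- s])); split; first exact: undup_uniq.
  apply: leq_trans (size_undup _) _; rewrite size_flatten expnS mulnC.
  apply: leq_trans (leq_mul ss (leqnn K)); elim: s {us ss sP} => //= y s IHs.
  by rewrite mulSn leq_add // (NP y).1.
move=> z xz; rewrite mem_undup; apply/flatten_mapP.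
have [w xw wz] : exists2 w, reach n x w & near w z.
  elim: n x xz {IH s us ss sP} => [x [w xw <-]|n IH x [w xw /IH[v wv vz]]].
    by exists x.
  by exists v => //; exists w.
by exists w; [exact: sP|apply: (NP w).2].
Qed.

(** Of two distinct points of [B], the name of each asserts a formula that the name of the other
    denies. Names thus exclude each other in every model of every frame, which lets them travel from
    the canonical model to a comb. *)
Lemma names (F : frame) (V : nat -> set F) (B : seq F) : differentiated V ->
  exists nm : F -> form, (forall b, sat V b (nm b)) /\
    forall (F' : frame) (V' : nat -> set F') x b b', b \in B -> b' \in B ->
      sat V' x (nm b) -> sat V' x (nm b') -> b = b'.
Proof.
move=> dV; have /choice[d dP] (p : F * F) : exists a, p.1 <> p.2 ->
    sat V p.1 a /\ ~ sat V p.2 a.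
  by have [pE|/dV[a aP]] := pselect (p.1 = p.2); [exists Bot|exists a].
exists (fun b => bigAnd [seq And (d (b, b')) (Neg (d (b', b)))
                        | b' <- B & b' != b]); split=> [b|F' V' x b b' bB b'B].
  apply/satAs => a /mapP[b']; rewrite mem_filter => /andP[/eqP nb _] ->.
  apply/satA; split; first by have [] := dP (b, b') (nesym nb).
  by apply/satN; have [] := dP (b', b) nb.
move=> /satAs h /satAs h'; have [//|/eqP nb] := eqVneq b b'.
have /satA[+ _] : sat V' x (And (d (b, b')) (Neg (d (b', b)))).
  by apply: h; apply: map_f; rewrite mem_filter b'B andbT; apply/eqP/nesym.
have /satA[_ /satN] : sat V' x (And (d (b', b)) (Neg (d (b, b')))).
  by apply: h'; apply: map_f; rewrite mem_filter bB andbT; apply/eqP.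
by [].
Qed.

Definition transfers (G : frame) (V : nat -> set G) (F : frame) : Prop :=
  forall a x, sat V x a -> exists (V' : nat -> set F) y, sat V' y a.

Lemma model_transfers (L : set form) (G : frame) (V : nat -> set G) (F : frame) :
  (forall a, L a -> forall x, sat V x a) -> logic_of F `<=` L -> transfers V F.
Proof.
move=> LV FL a x xa; apply: contrapT => h.
suff /FL/LV/(_ x) : logic_of F (Neg a) by exact.
by move=> V' y ya; apply: h; exists V', y.
Qed.

(** Distinct neighbours of [x] have mutually exclusive names, so the formula saying that each name
    occurs nearby forces as many distinct neighbours in [F]. *)
Lemma transfers_near_bounded K (F G : frame) (V : nat -> set G) :
  differentiated V -> transfers V F -> near_bounded K F -> near_bounded K G.
Proof.
move=> dV VF bF x.
pose P n := `[< exists s : seq G, [/\ uniq s, size s = n &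
  forall y, y \in s -> near x y] >].
have P0 : exists n, P n by exists 0; apply/asboolP; exists [::].
have PK n : P n -> n <= K.
  move=> /asboolP[s [us <- sx]]; have [nm [nmT nmI]] := names s dV.
  have [|W [w /satAs wP]] := VF (bigAnd [seq Delta (nm y) | y <- s]) x.
    apply/satAs => _ /mapP[y /sx xy ->]; apply/sat_Delta; by exists y.
  have {wP} wP y : exists z, y \in s -> near w z /\ sat W z (nm y).
    have [ys|_] := boolP (y \in s); last by exists w.
    by have /wP/sat_Delta[z] := map_f (fun y => Delta (nm y)) ys; exists z.
  have [f fP] := choice wP; have [t tK tP] := bF w.
  apply: leq_trans tK; rewrite -(size_map f); apply: uniq_leq_size.
    rewrite map_inj_in_uniq // => y z ys zs fyz.
    by have [_ fy] := fP _ ys; have [_] := fP _ zs; rewrite -fyz; apply: nmI fy.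
  by move=> _ /mapP[y ys ->]; apply: tP; have [] := fP _ ys.
have [n /asboolP[s [us sn sx]] nmax] := ex_maxnP P0 PK.
exists s; first by rewrite sn; apply: PK; apply/asboolP; exists s.
move=> y xy; apply: contrapT => /negP nys.
have /nmax : P n.+1; last by rewrite ltnn.
apply/asboolP; exists (y :: s); split=> [|/=|z]; first by rewrite /= nys.
  by rewrite sn.
by rewrite inE => /predU1P[->//|/sx].
Qed.

(** The axiom is instantiated with a name of [y] exclusive on the [n]-ball around [x]; it holds
    within [n] steps of [x] only if [y] lies there. *)
Lemma bz_reach K (G : frame) (V : nat -> set G) n :
  differentiated V -> near_bounded K G ->
  (forall s x, sat V x (subst s (bz n))) ->
  forall x y : G, reach n.+1 x y -> reach n x y.
Proof.
move=> dV bG Vbz x y xy; have [s [_ _ sP]] := reach_bounded bG n x.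
apply: contrapT => nxy; have [nm [nmT nmI]] := names (y :: s) dV.
have := Vbz (fun=> nm y) x.
have -> : subst (fun=> nm y) (bz n) =
    Imp (iter n.+1 Delta (nm y)) (iter n Delta (nm y)).
  exact: (f_equal2 Imp (subst_iter_Delta _ n.+1 _) (subst_iter_Delta _ n _)).
have /(sat_iter_Delta V n.+1) xS : exists2 z, reach n.+1 x z & sat V z (nm y).
  by exists y.
move=> /(_ xS)/sat_iter_Delta[z xz zy]; apply: nxy.
suff -> : y = z by [].
by apply: (nmI G V z); rewrite ?mem_head // inE sP ?orbT.
Qed.

(** * Bounded morphisms and tabularity of logics containing some [bz n] *)

(** [V] is pulled back from sets definable in the model on [G], not only from [W] itself; this is
    the purpose of the substitution. *)
Lemma sat_pmorph (F G : frame) (V : nat -> set F) (W : nat -> set G)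
    (D : set F) (h : F -> G) (s : nat -> form) :
  (forall x y, D x -> acc x y -> D y /\ acc (h x) (h y)) ->
  (forall x y, D x -> acc y x -> D y /\ acc (h y) (h x)) ->
  (forall x z, D x -> acc (h x) z -> exists2 y, acc x y & h y = z) ->
  (forall x z, D x -> acc z (h x) -> exists2 y, acc y x & h y = z) ->
  (forall i x, D x -> V i x <-> sat W (h x) (s i)) ->
  forall a x, D x -> sat V x a <-> sat W (h x) (subst s a).
Proof.
move=> f1 f2 b1 b2 VW; elim=> [i|//|a IHa b IHb|a IHa|a IHa] x Dx /=.
- exact: VW.
- by rewrite IHa // IHb.
- split=> [xa z /(b1 _ _ Dx)[y xy <-]|xa y xy].
    by apply/IHa; [have [] := f1 _ _ Dx xy|exact: xa].
  by have [Dy hxy] := f1 _ _ Dx xy; apply/IHa => //; exact: xa.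
- split=> [[y yx ya]|[z /(b2 _ _ Dx)[y yx <-]]].
    by have [Dy hyx] := f2 _ _ Dx yx; exists (h y) => //; apply/IHa.
  by have [Dy _] := f2 _ _ Dx yx => /IHa; exists y => //; auto.
Qed.

Lemma subst_Var a : subst Var a = a.
Proof. by elim: a => //= [a -> b ->|a ->|a ->]. Qed.

(* On a finite component of a differentiated model every set is definable, so
   the component validates all formulas true in the model. *)
Lemma component_valid (F G : frame) (V : nat -> set F) (W : nat -> set G)
    (D : set F) (h : F -> G) (B : seq G) (a : form) :
  differentiated W -> (forall s x, sat W x (subst s a)) ->
  (forall x y, D x -> acc x y -> D y /\ acc (h x) (h y)) ->
  (forall x y, D x -> acc y x -> D y /\ acc (h y) (h x)) ->
  (forall x z, D x -> acc (h x) z -> exists2 y, acc x y & h y = z) ->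
  (forall x z, D x -> acc z (h x) -> exists2 y, acc y x & h y = z) ->
  (forall x, D x -> h x \in B) ->
  (forall x y, D x -> D y -> h x = h y -> x = y) ->
  forall x, D x -> sat V x a.
Proof.
move=> dW Wa f1 f2 b1 b2 DB hI x Dx; have [nm [nmT nmI]] := names B dW.
pose s i := bigOr [seq nm b | b <- B & `[< exists2 y, D y & h y = b /\ V i y >]].
apply/(sat_pmorph (W := W) (s := s) f1 f2 b1 b2) => // i y Dy.
rewrite satOs; split=> [Viy|[c /mapP[b]]].
  exists (nm (h y)) => //; apply: map_f; rewrite mem_filter DB // andbT.
  by apply/asboolP; exists y.
rewrite mem_filter => /andP[/asboolP[z Dz [hz Viz]] bB] -> hyb.
rewrite (hI y z) // hz; apply: (nmI _ W (h y)); rewrite ?DB //.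
Qed.

Lemma ntl_past L a : normal_tense_logic L -> L a -> L (Neg (Past (Neg a))).
Proof.
move=> nL La; apply/(ntl_adjoint nL); apply: ntl_mp La => //.
by apply: ntl_taut => //; taut.
Qed.

(** By [bz n], components of the canonical model have at most [K ^ n] points, so copies of all of
    them occur in one finite frame; the part of that frame validating [L] has logic [L]. *)
Lemma tabular_bz K (F : frame) (L : set form) n :
  normal_tense_logic L -> consistent L -> near_bounded K F ->
  logic_of F `<=` L -> L (bz n) -> tabular L.
Proof.
move=> nL cL bF FL Lbz; have [G [V [dV LV]]] := canonical_model nL cL.
have bG : near_bounded K G.
  exact: transfers_near_bounded dV (model_transfers (fun a => (LV a).1) FL) bF.
have Lsub a s x : L a -> sat V x (subst s a).
  by move=> La; apply/LV: x; exact: ntl_subst.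
have bz1 := bz_reach dV bG (fun s x => Lsub _ s x Lbz).
have Bex (c : G) : exists B : seq G, [/\ uniq B, size B <= K ^ n, c \in B &
    forall x y, x \in B -> near x y -> y \in B].
  have [s [us sK sP]] := reach_bounded bG n c.
  exists [seq y <- s | `[< reach n c y >]]; split.
  - exact: filter_uniq.
  - by apply: leq_trans sK; rewrite size_filter count_size.
  - rewrite mem_filter sP ?andbT; last exact: reach_refl.
    by apply/asboolP; exact: reach_refl.
  - move=> x y; rewrite !mem_filter => /andP[/asboolP cx _] xy.
    have cy : reach n c y by apply: bz1; exact: reach_rcons xy.
    by rewrite sP // andbT; apply/asboolP.
(* The disjoint union of all binary relations on [(K ^ n).+1] indices; a point is a relation with an
   index. The successor keeps the index type inhabited. *)
pose T := ({ffun 'I_(K ^ n).+1 * 'I_(K ^ n).+1 -> bool} * 'I_(K ^ n).+1)%type.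
pose TF := @Frame T (inhabits ([ffun=> false], ord0))
  (fun p q => p.1 = q.1 /\ p.1 (p.2, q.2)).
pose good (p : T) := forall a (W : nat -> set TF), L a -> sat W (p : TF) a.
have good1 (p q : TF) : good p -> acc p q -> good q.
  move=> gp pq a W La; exact: (gp (Box a) W (ntl_nec nL La)) pq.
have good2 (p q : TF) : good p -> acc q p -> good q.
  move=> gp qp a W La; apply: contrapT => nq.
  by have := gp _ W (ntl_past nL La); apply; exists q.
have comp (c : G) : exists (D : set T) (h : T -> G) (p : T),
  [/\ (D p /\ h p = c), D `<=` good,
      (forall x y : TF, D x -> acc x y -> D y /\ acc (h x) (h y)) /\
      (forall x y : TF, D x -> acc y x -> D y /\ acc (h y) (h x)),
      (forall (x : TF) z, D x -> acc (h x) z -> exists2 y : TF, acc x y & h y = z)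
    & (forall (x : TF) z, D x -> acc z (h x) -> exists2 y : TF, acc y x & h y = z)].
  have [B [uB BK cB Bcl]] := Bex c.
  (* Points of the component are coded by positions in [B]; indices from [size B] on are related to
     nothing, so no edge leaves [D]. *)
  pose r : {ffun 'I_(K ^ n).+1 * 'I_(K ^ n).+1 -> bool} :=
    [ffun p : 'I_(K ^ n).+1 * 'I_(K ^ n).+1 => `[< [/\ p.1 < size B, p.2 < size B &
                    acc (nth c B p.1) (nth c B p.2)] >]].
  pose D : set T := [set p : T | p.1 = r /\ p.2 < size B].
  pose h (p : T) := nth c B p.2.
  have idx z : z \in B -> exists i : 'I_(K ^ n).+1, i < size B /\ nth c B i = z.
    move=> zB; have zi : index z B < size B by rewrite index_mem.
    have zK : index z B < (K ^ n).+1 by apply: leq_trans zi (leqW BK).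
    by exists (Ordinal zK); rewrite /= nth_index.
  have hB p : D p -> h p \in B by case=> _ pB; rewrite mem_nth.
  have f1 (x y : TF) : D x -> acc x y -> D y /\ acc (h x) (h y).
    case: x y => [x i] [y j] [/= -> iB] [/= <-]; rewrite ffunE => /asboolP[/= _ jB ij].
    by [].
  have f2 (x y : TF) : D x -> acc y x -> D y /\ acc (h y) (h x).
    case: x y => [x i] [y j] [/= -> iB] [/= ->]; rewrite ffunE => /asboolP[/= jB _ ij].
    by [].
  have b1 (x : TF) z : D x -> acc (h x) z -> exists2 y : TF, acc x y & h y = z.
    move=> Dx hxz; have [|i [iB iz]] := idx z.
      by apply: Bcl (hB _ Dx) _; apply: Or32.
    exists (r, i) => //; case: x Dx hxz => [x j] [/= -> jB] hxz.
    by split=> //=; rewrite ffunE; apply/asboolP; split=> //=; rewrite iz.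
  have b2 (x : TF) z : D x -> acc z (h x) -> exists2 y : TF, acc y x & h y = z.
    move=> Dx hxz; have [|i [iB iz]] := idx z.
      by apply: Bcl (hB _ Dx) _; apply: Or33.
    exists (r, i) => //; case: x Dx hxz => [x j] [/= -> jB] hxz.
    by split=> //=; rewrite ffunE; apply/asboolP; split=> //=; rewrite iz.
  have [i0 [i0B i0c]] := idx c cB.
  exists D, h, (r, i0); split=> // p Dp a W La.
  apply: (@component_valid TF G W V D h B a dV _ f1 f2 b1 b2 hB _ p Dp).
    by move=> s x; exact: Lsub.
  move=> [x i] [y j] [/= -> iB] [/= -> jB] /eqP; rewrite /h /= nth_uniq // => /eqP ij.
  by congr pair; exact: val_inj.
pose W := {p : T | `[< good p >]}.
have inW (D : set T) p : D `<=` good -> D p -> `[< good p >].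
  by move=> Dg /Dg/asboolP.
have W0 : inhabited W.
  have [c] := world_nonempty G; have [D [h [p [[Dp _] Dg _ _ _]]]] := comp c.
  by constructor; exists p; apply: inW Dp.
pose WF := @Frame W W0 (fun v w => @acc TF (val v) (val w)).
have valgood (w : WF) : good (val w) by apply/asboolP; exact: (svalP w).
exists WF; first exact: (@finite_finset W).
apply/seteqP; split=> a.
  move=> La U w; pose U' i : set TF := [set p | exists2 v : WF, val v = p & U i v].
  apply/(@sat_pmorph WF TF U U' setT val Var) => //.
  - move=> x z _ xz; have gz : `[< good z >] by apply/asboolP; exact: good1 xz.
    by exists (Sub z gz : W).
  - move=> x z _ xz; have gz : `[< good z >] by apply/asboolP; exact: good2 xz.
    by exists (Sub z gz : W).
  - move=> i x _; split=> [Ux|[v vx]]; first by exists x.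
    by rewrite (_ : x = v) //; apply: val_inj.
  - by rewrite subst_Var; apply: (valgood w).
(* Conversely, every canonical point [c] has a copy in [WF]; with the valuation pulled back,
   validity on [WF] gives truth at [c]. *)
move=> WFa; apply/LV => c; have [D [h [p [[Dp hp] Dg [f1 f2] b1 b2]]]] := comp c.
pose w : WF := (Sub p (inW _ _ Dg Dp) : W).
have := WFa (fun i => [set v : WF | V i (h (val v))]) w.
move/(@sat_pmorph WF G _ V [set v : WF | D (val v)] (fun v => h (val v)) Var).
rewrite subst_Var /= hp; apply=> //.
- by move=> x y; exact: f1.
- by move=> x y; exact: f2.
- move=> x z Dx /(b1 _ _ Dx)[q xq hq]; have [Dq _] := f1 _ _ Dx xq.
  by exists (Sub q (inW _ _ Dg Dq) : W).
- move=> x z Dx /(b2 _ _ Dx)[q xq hq]; have [Dq _] := f2 _ _ Dx xq.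
  by exists (Sub q (inW _ _ Dg Dq) : W).
Qed.

(* [Z k] is the relation of satisfying the characteristic formula of depth [k]
   of a point of the finitely branching differentiated model. *)
Lemma bounded_bisimulation K (G F : frame) (V : nat -> set G) (B : seq G) n (c : G) :
  differentiated V -> near_bounded K G -> transfers V F ->
  exists (Z : nat -> F -> G -> Prop) (x : F),
  [/\ Z n x c,
      forall k x b b', acc b b' -> Z k.+1 x b -> exists2 x', acc x x' & Z k x' b',
      forall k x b b', acc b' b -> Z k.+1 x b -> exists2 x', acc x' x & Z k x' b',
      (forall k x b x', acc x x' -> Z k.+1 x b -> exists2 b', acc b b' & Z k x' b') /\
      (forall k x b x', acc x' x -> Z k.+1 x b -> exists2 b', acc b' b & Z k x' b')
    & forall k k' x b b', b \in B -> b' \in B -> Z k x b -> Z k' x b' -> b = b'].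
Proof.
move=> dV bG VF; have /choice[N NP] (x : G) : exists s : seq G,
    forall y, near x y -> y \in s by have [s] := bG x; exists s.
have [nm [nmT nmI]] := names B dV.
pose up b := [seq b' <- N b | `[< acc b b' >]].
pose dn b := [seq b' <- N b | `[< acc b' b >]].
have upP b b' : b' \in up b <-> acc b b'.
  rewrite mem_filter; split=> [/andP[/asboolP] //|bb'].
  by rewrite (NP b) ?andbT; [apply/asboolP|apply: Or32].
have dnP b b' : b' \in dn b <-> acc b' b.
  rewrite mem_filter; split=> [/andP[/asboolP] //|bb'].
  by rewrite (NP b) ?andbT; [apply/asboolP|apply: Or33].
pose chi := fix chi k b := if k is k'.+1 then
  bigAnd [:: nm b; bigAnd [seq Dia (chi k' b') | b' <- up b];
             bigAnd [seq Past (chi k' b') | b' <- dn b];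
             Box (bigOr [seq chi k' b' | b' <- up b]);
             Neg (Past (Neg (bigOr [seq chi k' b' | b' <- dn b])))]
  else nm b.
have chinm k (V' : nat -> set F) x b : sat V' x (chi k b) -> sat V' x (nm b).
  by case: k => // k; rewrite /chi satAs; apply; rewrite mem_head.
have chiT k b : sat V b (chi k b).
  elim: k b => [|k IH] b; first exact: nmT.
  rewrite /chi -/chi satAs => a; rewrite !inE => /or4P[/eqP->|/eqP->|/eqP->|].
  - exact: nmT.
  - by apply/satAs => _ /mapP[b' /upP bb' ->]; apply/satD; exists b'.
  - by apply/satAs => _ /mapP[b' /dnP bb' ->]; exists b'.
  - case/orP=> /eqP-> => [b' bb'|[b' bb']]; last apply.
      by apply/satOs; exists (chi k b') => //; apply: map_f; apply/upP.
    by apply/satOs; exists (chi k b') => //; apply: map_f; apply/dnP.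
have [V' [x xc]] := VF _ _ (chiT n c).
exists (fun k x b => sat V' x (chi k b)), x.
have chiE k y b a : sat V' y (chi k.+1 b) ->
    a \in [:: nm b; bigAnd [seq Dia (chi k b') | b' <- up b];
             bigAnd [seq Past (chi k b') | b' <- dn b];
             Box (bigOr [seq chi k b' | b' <- up b]);
             Neg (Past (Neg (bigOr [seq chi k b' | b' <- dn b])))] -> sat V' y a.
  by rewrite {1}/chi -/chi satAs; apply.
split=> //; first 2 last; first split.
- move=> k y b z yz /chiE - /(_ (Box (bigOr [seq chi k b' | b' <- up b]))).
  rewrite !inE eqxx !orbT => /(_ isT)/(_ _ yz)/satOs[_ /mapP[b' /upP bb' ->]].
  by exists b'.
- move=> k y b z zy /chiE -
    /(_ (Neg (Past (Neg (bigOr [seq chi k b' | b' <- dn b]))))).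
  rewrite !inE eqxx !orbT => /(_ isT) h.
  have /satOs[_ /mapP[b' /dnP bb' ->]] : sat V' z (bigOr [seq chi k b' | b' <- dn b]).
    by apply: contrapT => nz; apply: h; exists z.
  by exists b'.
- move=> k k' y b b' bB b'B /chinm yb /chinm yb'; exact: nmI yb yb'.
- move=> k y b b' bb' /chiE - /(_ (bigAnd [seq Dia (chi k b') | b' <- up b])).
  rewrite !inE eqxx !orbT => /(_ isT)/satAs/(_ (Dia (chi k b'))).
  by move=> h; apply/satD; apply: h; apply: map_f; apply/upP.
- move=> k y b b' bb' /chiE - /(_ (bigAnd [seq Past (chi k b') | b' <- dn b])).
  rewrite !inE eqxx !orbT => /(_ isT)/satAs/(_ (Past (chi k b'))).
  by apply; apply: map_f; apply/dnP.
Qed.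

(** * Comb frames *)

(** Pigeonhole: among [n.+1] witnesses either one is [x] itself, which is related to all others, or
    two coincide in the list of at most [n] points. *)
Lemma bw_valid (F : frame) (M : form -> form) (R : F -> F -> Prop) n :
  (forall V (x : F) a, sat V x (M a) <-> exists2 y, R x y & sat V y a) ->
  0 < n ->
  (forall x, exists2 s : seq F, size s <= n & forall y, R x y -> y = x \/ y \in s) ->
  logic_of F (bw M n).
Proof.
move=> satM n0 sR V x.
have xpA xp := (satAs V x [seq M (Var i) | i <- iota 0 n.+1]).1 xp.
move=> /xpA xp {xpA}; have [s sn sP] := sR x.
have /choice[f fP] i : exists y, i < n.+1 -> R x y /\ V i y.
  have [ni|_] := ltnP i n.+1; last by exists x.
  have /xp/satM[y xy yi] : M (Var i) \in [seq M (Var i) | i <- iota 0 n.+1].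
    by apply/map_f; rewrite mem_iota.
  by exists y.
suff [i [j [iN jN ij fij]]] : exists i j, [/\ i < n.+1, j < n.+1, i != j &
    f j = f i \/ R (f i) (f j)].
  have [xi Vi] := fP _ iN; have [xj Vj] := fP _ jN.
  apply/satOs; exists (M (And (Var i) (Or (Var j) (M (Var j))))).
    apply/allpairsPdep; exists i, j; split=> //; first by rewrite mem_iota.
    by rewrite mem_filter mem_iota eq_sym ij.
  apply/satM; exists (f i) => //; apply/satA; split=> //; apply/satO.
  case: fij => [<-|fij]; [by left|right].
  by apply/satM; exists (f j).
have [[i iN fi]|nx] := pselect (exists2 i, i < n.+1 & f i = x).
  have [i0|i0] := eqVneq i 0.
    rewrite i0 in fi; exists 0, 1; rewrite fi; split=> //; right.
    by have [] := fP 1 n0.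
  by exists i, 0; rewrite fi; split=> //; right; have [] := fP 0 isT.
have : ~~ uniq [seq f i | i <- iota 0 n.+1].
  apply/negP => u; suff : n < size s by rewrite ltnNge sn.
  rewrite -[n.+1](size_iota 0) -(size_map f).
  apply: uniq_leq_size u _ => _ /mapP[i iN ->].
  rewrite mem_iota /= add0n in iN; have [xi _] := fP _ iN.
  by have [fi|//] := sP _ xi; case: nx; exists i.
move=> /(uniqPn x)[i [j [ij]]]; rewrite size_map size_iota => jN.
rewrite !(nth_map 0) ?size_iota //; last exact: ltn_trans ij jN.
rewrite !nth_iota //; last exact: ltn_trans ij jN.
rewrite !add0n => fij.
by exists i, j; split=> //; [exact: ltn_trans ij jN|rewrite ltn_eqF|left].
Qed.

Inductive comb : Type := Ln of nat | Pd of nat.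

Section Comb.
Variable w : nat -> bool.

(* The vertices [Ln k] form a zigzag line whose maximal points are the odd ones;
   the maximal point [Ln (2 n).+1] has a third point [Pd (2 n).+1] below it iff
   [w n]; the remaining points [Pd k] are isolated. *)
Definition cover (p q : comb) : bool :=
  match p, q with
  | Ln i, Ln j => ~~ odd i && ((j == i.+1) || (i == j.+1))
  | Pd i, Ln j => [&& i == j, odd j & w j./2]
  | _, Pd _ => false
  end.

Definition comb_frame : frame :=
  @Frame comb (inhabits (Ln 0)) (fun p q => p = q \/ cover p q).

Notation CF := comb_frame.

(** It changes by at most one along [near], hence bounds the distance from [Ln 0] from below. *)
Definition coord (p : comb) : nat := match p with Ln k => k | Pd k => k.+1 end.

Lemma coord_near (p q : CF) : near p q -> coord q <= (coord p).+1.
Proof.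
case=> [->|[->|]|[->|]] //.
- by case: p q => [i|i] [j|j] //=; lia.
- by case: p q => [i|i] [j|j] //=; lia.
Qed.

Lemma coord_reach n (p q : CF) : reach n p q -> coord q <= coord p + n.
Proof.
elim: n p => [p ->|n IH p [r /coord_near pr /IH]]; lia.
Qed.

Lemma near_Ln i : near (Ln i : CF) (Ln i.+1).
Proof.
have [o|e] := boolP (odd i).
  by apply: Or33; right; rewrite /= o eqxx orbT.
by apply: Or32; right; rewrite /= e eqxx.
Qed.

Lemma reach_Ln n : reach n (Ln 0 : CF) (Ln n).
Proof. by elim: n => // n IH; exact: reach_rcons IH (near_Ln n). Qed.

Lemma comb_not_bz n : ~ logic_of CF (bz n).
Proof.
move=> /(_ (fun _ => [set Ln n.+1 : CF]) (Ln 0)) h.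
have /h/sat_iter_Delta[q nq /= qE] : sat (fun _ => [set Ln n.+1 : CF])
    (Ln 0 : CF) (iter n.+1 Delta (Var 0)).
  by apply/sat_iter_Delta; exists (Ln n.+1) => //; exact: reach_Ln.
by have := coord_reach nq; rewrite qE /= add0n ltnn.
Qed.

Lemma coverP p q : cover p q ->
  [\/ exists k, [/\ ~~ odd k, p = Ln k & q = Ln k.+1],
      exists k, [/\ odd k, p = Ln k.+1 & q = Ln k] |
      exists k, [/\ odd k, w k./2, p = Pd k & q = Ln k]].
Proof.
case: p q => [i|i] [j|j] //= => [/andP[oi /orP[]/eqP E]|/and3P[/eqP<- oi wi]].
- by apply: Or31; exists i; rewrite E.
- by apply: Or32; exists j; move: oi; rewrite E /= negbK.
- by apply: Or33; exists i.
Qed.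

Lemma comb_near_bounded : near_bounded 4 CF.
Proof.
case=> k; [exists [:: Ln k; Ln k.-1; Ln k.+1; Pd k : CF]|
           exists [:: Pd k; Ln k : CF]] => // q.
- case=> [<-|[<-|/coverP]|[->|/coverP]]; rewrite ?mem_head //.
  + by case=> -[j [//]] => [_ [->] ->|_ [->] ->]; rewrite !inE eqxx ?orbT.
  + by case=> -[j [//]] => [_ -> [->]|_ -> [->]|_ _ -> [->]]; rewrite !inE eqxx ?orbT.
- case=> [<-|[<-|/coverP]|[->|/coverP]]; rewrite ?mem_head //.
  + by case=> -[j [//]] => _ _ [->] ->; rewrite !inE eqxx ?orbT.
  + by case=> -[j [//]].
Qed.

Lemma cover_cover p q r : cover p q -> cover q r -> False.
Proof. by case: p q r => [i|i] [j|j] [k|k] //=; lia. Qed.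

Lemma comb_S4BP : S4BP (Fin 2) Omega (Fin 2) (Fin 3) `<=` logic_of CF.
Proof.
apply: smallest_sub; first exact: logic_of_normal.
rewrite subUset; split.
  apply: smallest_sub; first exact: logic_of_normal.
  rewrite subUset; split.
    by apply: smallest_sub; [exact: logic_of_normal|exact: sub0set].
  move=> _ [->|->] V p /=; first by apply; left.
  move=> h q pq r qr; apply: h; case: pq qr => [->|pq] // [<-|qr]; right=> //.
  by case: (cover_cover pq qr).
move=> _ [[[->|->]|->]|->].
(* If [bd 1] fails at [q], then [q] has a proper successor; covers do not compose, so [p] is [q]. *)
- move=> V p h; have {h} [q pq h] :=
    (satD V p (And (Box (Var 1)) (Neg (bd 1)))).1 h.
  have {h} [q1 nq] := (satA V q (Box (Var 1)) (Neg (bd 1))).1 h.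
  have {nq} /not_implyP[h nq0] : ~ (sat V q (Dia (Box (Var 0))) -> V 0 q) by [].
  have {h} [r qr r0] := (satD V q (Box (Var 0))).1 h.
  case: pq => [->|pq]; first by apply: q1; left.
  case: qr => [qr|qr]; first by case: nq0; apply: r0; left.
  by case: (cover_cover pq qr).
- by move=> V p.
- apply: (bw_valid (R := @acc CF)) => //; first by move=> V x a; exact: satD.
  case=> k; [exists [:: Ln k.-1; Ln k.+1 : CF]|exists [:: Ln k : CF]] => // q.
  + case=> [->|/coverP]; first by left.
    by case=> -[j [//]] => [_ [->] ->|_ [->] ->]; right; rewrite !inE eqxx ?orbT.
  + case=> [->|/coverP]; first by left.
    by case=> -[j [//]] => _ _ [->] ->; right; rewrite mem_head.
- apply: (bw_valid (R := fun x y => @acc CF y x)) => //.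
  case=> k; [exists [:: Ln k.-1; Ln k.+1; Pd k : CF]|exists [::]] => // q.
  + case=> [->|/coverP]; first by left.
    by case=> -[j [//]] => [_ -> [->]|_ -> [->]|_ _ -> [->]]; right;
      rewrite !inE eqxx ?orbT.
  + by case=> [->|/coverP]; [left|case=> -[j []]].
Qed.

End Comb.

(** * Straight paths and their lifts to comb frames *)

Definition step (F : frame) (b : bool) (x y : F) : Prop :=
  if b then acc x y else acc y x.

Lemma step_near (F : frame) b (x y : F) : step b x y -> near x y.
Proof. by case: b => xy; [apply: Or32|apply: Or33]. Qed.

(** Only stalling and immediate backtracking are excluded: such local conditions can be transported
    by names. *)
Definition straight (F : frame) (m : nat) (e : nat -> bool) (g : nat -> F) : Prop :=
  [/\ forall i, i < m -> step (e i) (g i) (g i.+1),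
      forall i, i < m -> g i <> g i.+1 &
      forall i, i.+1 < m -> g i <> g i.+2].

(** A pendant has at most one neighbour besides itself, so a path through it would backtrack; the
    rest runs along the line in one direction. Odd points are maximal, hence entered upwards and
    left downwards. The endpoints may be pendants, whence the bounds on [i]. *)
Lemma straight_comb w m e (x : nat -> comb_frame w) : straight m e x ->
  exists k : nat -> nat,
  [/\ forall i, 0 < i < m -> x i = Ln (k i),
      forall i, 0 < i < m -> odd (k i) = e i.-1 /\ odd (k i) = ~~ e i &
      (forall i, 0 < i < m -> k i = k 1 + i.-1) \/
      (forall i, 0 < i < m -> k i + i.-1 = k 1)].
Proof.
move=> [xe x1 x2].
have cov i : i < m -> if e i then cover w (x i) (x i.+1) else cover w (x i.+1) (x i).
  move=> im; have := xe i im; rewrite /step; case: (e i) => -[E|//].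
    by case: (x1 i im).
  by case: (x1 i im).
pose k i := coord (x i).
have xk i : 0 < i < m -> x i = Ln (k i).
  case: i => // i /andP[_ im]; rewrite /k; case xi: (x i.+1) => [//|j].
  case: (x2 i im); have := cov i (ltnW im); have := cov _ im; rewrite xi.
  case: ifP => _ /coverP[] [a [//]] => _ _ [->] ->.
  by case: ifP => _ /coverP[] [b [//]] => _ _ [->] ->.
clearbody k; have kS i : 0 < i -> i.+1 < m -> k i.+1 = (k i).+1 \/ k i = (k i.+1).+1.
  move=> i0 im; have := cov i (ltnW im).
  rewrite (xk i ltac:(lia)) (xk i.+1 ltac:(lia)).
  by case: ifP => ei /coverP[] [a [//]] =>
    [_ [->] [->]|_ [->] [->]|_ [->] [->]|_ [->] [->]]; auto.
have kT i : 0 < i -> i.+2 < m -> k i <> k i.+2.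
  move=> i0 im E; apply: (x2 i (ltnW im)).
  by rewrite (xk i ltac:(lia)) (xk i.+2 ltac:(lia)) E.
exists k; split=> //.
- move=> i im; split.
    case: i im => // i /andP[_ im]; have := cov i (ltnW im); rewrite (xk i.+1) //.
    case: ifP => ei /coverP[] [a [//]].
    + by move=> /negbTE oa _ [->] /=; rewrite oa.
    + by move=> oa _ [->].
    + by move=> oa _ _ [->].
    + by move=> /negbTE oa [->].
    + by move=> oa [->] /= _; rewrite oa.
  have /andP[_ im'] := im; have := cov i im'; rewrite (xk i) //.
  case: ifP => ei /coverP[] [a [//]].
  + by move=> /negbTE oa [->].
  + by move=> oa [->] /= _; rewrite oa.
  + by move=> /negbTE oa _ [->] /=; rewrite oa.
  + by move=> oa _ [->].
  + by move=> oa _ _ [->].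
- have [m2|m2] := ltnP 2 m; last first.
    by left=> i im; rewrite (_ : i = 1) ?addn0 //; lia.
  have [up|dn] := kS 1 isT m2; [left|right].
  + have H i : i.+2 < m -> k i.+2 = (k i.+1).+1.
      elim: i => [//|i IH] im; have := kS i.+2 isT im; have := IH (ltnW im).
      by have := kT i.+1 isT im; lia.
    elim=> // -[|i] IH im; first by rewrite addn0.
    by rewrite H; [rewrite IH /=; lia|lia].
  + have H i : i.+2 < m -> k i.+1 = (k i.+2).+1.
      elim: i => [//|i IH] im; have := kS i.+2 isT im; have := IH (ltnW im).
      by have := kT i.+1 isT im; lia.
    elim=> // -[|i] IH im; first by rewrite addn0.
    by have := H i; have := IH; lia.
Qed.

Definition three_below (F : frame) (y : F) : Prop :=
  exists u v z : F, [/\ u <> v, u <> z & v <> z] /\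
    [/\ u <> y, v <> y & z <> y] /\ [/\ acc u y, acc v y & acc z y].

(** The bounded bisimulation turns [g] into a straight path of the comb, spending one level per
    step. In the last clause the bounds on [i] leave two path points on either side of the peak. *)
Lemma straight_lift w (G : frame) (V : nat -> set G) m e (g : nat -> G) :
  differentiated V -> transfers V (comb_frame w) -> straight m e g ->
  exists k : nat -> nat,
  [/\ forall i, 0 < i < m -> odd (k i) = e i.-1,
      (forall i, 0 < i < m -> k i = k 1 + i.-1) \/
      (forall i, 0 < i < m -> k i + i.-1 = k 1)
    & forall i, 1 < i -> i.+1 < m -> odd (k i) ->
        (three_below (g i) <-> w (k i)./2)].
Proof.
move=> dV VF sg; have [ge g1 g2] := sg.
have bG := transfers_near_bounded dV VF (@comb_near_bounded w).
(* Radius [m.+1] covers the path and the neighbours of its points; depth [m.+2] leaves two levels at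
   its end. *)
have [B [_ _ BP]] := reach_bounded bG m.+1 (g 0).
have [Z [x0 [Zx0 Zup Zdn [Zup' Zdn'] ZI]]] :=
  bounded_bisimulation B m.+2 (g 0) dV bG VF.
have rg i : i <= m -> reach i (g 0) (g i).
  move=> im; apply: (@path_reach _ g m _ 0 i) => // j jm.
  exact: step_near (ge _ jm).
have gB i : i <= m -> g i \in B.
  by move=> im; apply: BP; apply: reach_mono (rg _ im); exact: leqW.
have uB i u : i <= m -> acc u (g i) -> u \in B.
  move=> im ui; apply: BP; have := reach_rcons (rg _ im) (Or33 _ _ ui).
  by apply: reach_mono.
have [x [xZ xe]] : exists x : nat -> comb_frame w,
    (forall i, i <= m -> Z (m.+2 - i) (x i) (g i)) /\
    (forall i, i < m -> step (e i) (x i) (x i.+1)).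
  suff /(_ m (leqnn m)) : forall n, n <= m -> exists x : nat -> comb_frame w,
    (forall i, i <= n -> Z (m.+2 - i) (x i) (g i)) /\
    (forall i, i < n -> step (e i) (x i) (x i.+1)) by [].
  elim=> [|n IH] nm.
    by exists (fun=> x0); split=> // i; rewrite leqn0 => /eqP->; rewrite subn0.
  have [x [xZ xe]] := IH (ltnW nm).
  have [y xy yZ] : exists2 y, step (e n) (x n) y & Z (m.+2 - n.+1) y (g n.+1).
    have := ge _ nm; have := xZ n (leqnn n).
    rewrite (_ : m.+2 - n = (m.+2 - n.+1).+1); last lia.
    by rewrite /step; case: (e n) => zn gn; [exact: Zup gn zn|exact: Zdn gn zn].
  exists (fun i => if i <= n then x i else y); split=> i.
    rewrite leq_eqVlt => /predU1P[->|]; first by rewrite ltnn.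
    by rewrite ltnS => im; rewrite im; exact: xZ.
  by case: (ltngtP i n) => [im _|ni im|-> _]; [exact: xe|lia|].
have sx : straight m e x.
  split=> // i im E.
    apply: (g1 i im); apply: ZI (xZ _ im); rewrite ?gB // 1?ltnW //.
    by rewrite -E; apply: xZ; exact: ltnW.
  apply: (g2 i im); apply: ZI (xZ _ im); rewrite ?gB //; try lia.
  by rewrite -E; apply: xZ; lia.
have [k [xk ke kmono]] := straight_comb sx.
exists k; split=> //; first by move=> i /ke[].
move=> i i1 im oi.
have [i' iE] : exists i', i = i'.+2 by exists i.-2; lia.
subst i; have {i1} iM : i'.+2 <= m by lia.
have [ei1 ei2] : e i'.+1 /\ ~~ e i'.+2.
  by have [/= <- <-] := ke i'.+2 ltac:(lia).
have ei0 : ~~ e i'.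
  have [/= E1 E2] := ke i'.+1 ltac:(lia).
  by rewrite -E1 E2 negbK.
have ei3 : e i'.+3.
  have [/= E1 E2] := ke i'.+3 ltac:(lia).
  by apply: contraNT ei2 => /negbTE; rewrite -E1 E2 => ->.
have a0 : acc (g i'.+1) (g i') by have := ge i' ltac:(lia); rewrite /step (negbTE ei0).
have a1 : acc (g i'.+1) (g i'.+2) by have := ge i'.+1 ltac:(lia); rewrite /step ei1.
have a2 : acc (g i'.+3) (g i'.+2).
  by have := ge i'.+2 ltac:(lia); rewrite /step (negbTE ei2).
have a3 : acc (g i'.+3) (g i'.+4) by have := ge i'.+3 ltac:(lia); rewrite /step ei3.
have xi : x i'.+2 = Ln (k i'.+2) by apply: xk; lia.
have Zi := xZ _ iM; rewrite xi in Zi.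
have nE : m.+2 - i'.+2 = (m.+2 - i'.+4).+2 by lia.
rewrite nE in Zi.
split=> [[u [v [z [[uv uz vz] [[ui vi zi] [au av az]]]]]]|wk].
  (* Without a pendant the peak has only two proper predecessors in the comb, so two of [u], [v],
     [z] would match the same comb point and be equal. *)
  apply: contrapT => nw.
  have low t : t <> g i'.+2 -> acc t (g i'.+2) ->
      exists y, Z (m.+2 - i'.+4).+1 y t /\ exists b : bool,
        y = Ln (if b then (k i'.+2).+1 else (k i'.+2).-1).
    move=> ti at_; have [y yi Zy] := Zdn _ _ _ _ at_ Zi; exists y; split=> //.
    case: yi => [E|/coverP[] [a [//]]].
    - by case: ti; rewrite E in Zy; apply: ZI Zy Zi; [apply: uB at_|apply: gB].
    - by move=> _ -> [->]; exists false.
    - by move=> _ -> [->]; exists true.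
    - by move=> _ wa _ [E]; rewrite -E in wa.
  have [yu [Zu [bu Eu]]] := low u ui au.
  have [yv [Zv [bv Ev]]] := low v vi av.
  have [yz [Zz [bz Ez]]] := low z zi az.
  have UB t : acc t (g i'.+2) -> t \in B by apply: uB.
  have [E|nuv] := eqVneq bu bv.
    by apply: uv; rewrite Ev -E -Eu in Zv; apply: ZI Zu Zv; exact: UB.
  have [E|nuz] := eqVneq bu bz.
    by apply: uz; rewrite Ez -E -Eu in Zz; apply: ZI Zu Zz; exact: UB.
  have E : bv = bz by move: nuv nuz; case: (bu) (bv) (bz) => [] [] [].
  by apply: vz; rewrite Ez -E -Ev in Zz; apply: ZI Zv Zz; exact: UB.
have pk : @acc (comb_frame w) (Pd (k i'.+2)) (Ln (k i'.+2)).
  by right; rewrite /= eqxx oi wk.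
(* In [B], the point [u] matched with the pendant sees only itself and the peak, while the two path
   points below the peak each see another path point. It is not the peak, because a pendant has no
   proper predecessor. *)
have [u ui Zu] := Zdn' _ _ _ _ pk Zi.
have uBu : u \in B by apply: uB ui.
have above b : b \in B -> acc u b -> b = u \/ b = g i'.+2.
  move=> bB ub; have [y yb Zy] := Zup _ _ _ _ ub Zu.
  case: yb => [E|/coverP[] [a [//]]].
    by left; rewrite -E in Zy; apply: ZI Zy Zu.
  move=> _ _ [<-] E; right; rewrite E in Zy.
  by apply: ZI Zy Zi => //; exact: gB.
have n1 : u <> g i'.+1.
  move=> E; have := above (g i') (gB i' ltac:(lia)); rewrite E => /(_ a0)[F|F].
    by apply: (g1 i'); [lia|].
  by apply: (g2 i'); [lia|].
have n3 : u <> g i'.+3.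
  move=> E; have := above (g i'.+4) (gB i'.+4 ltac:(lia)); rewrite E => /(_ a3)[F|F].
    by apply: (g1 i'.+3); [lia|].
  by apply: (g2 i'.+2); [lia|].
have n2 : u <> g i'.+2.
  move=> E; rewrite E in Zu; have [y yb Zy] := Zdn _ _ _ _ a1 Zu.
  case: yb => [F|/coverP[] [a [//]]].
  apply: (g1 i'.+1); first lia.
  by rewrite F in Zy; apply: ZI Zy Zu; apply: gB; lia.
exists (g i'.+1), (g i'.+3), u; split; [|split] => //; split=> //.
- by apply: (g2 i'.+1); lia.
- exact/nesym.
- exact/nesym.
- by apply: (g1 i'.+1); lia.
- by apply/nesym; apply: (g1 i'.+2); lia.
Qed.

(** * Ruler sequences *)

(** The binary number with digits [x 0], ..., [x K.-1], most significant first. *)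
Fixpoint prefix_value (K : nat) (x : nat -> bool) : nat :=
  if K is k.+1 then x 0 * 2 ^ k + prefix_value k (x \o succn) else 0.

Lemma prefix_valueSr K x : prefix_value K.+1 x = (prefix_value K x).*2 + x K.
Proof.
elim: K x => [|K IH] x; first by rewrite /= muln1 addn0.
rewrite [LHS]/= -/(prefix_value K.+1 _) IH /= expnS; lia.
Qed.

Lemma eq_prefix_value K x y : (forall i, i < K -> x i = y i) ->
  prefix_value K x = prefix_value K y.
Proof.
elim: K => // K IH xy; rewrite !prefix_valueSr IH ?xy // => i iK.
exact/xy/ltnW.
Qed.

(* In a window of length [2 ^ K], the value [x i] with [i < K] is taken exactly
   [2 ^ (K - 1 - i)] times, and exactly one further value occurs. *)
Lemma sum_ruler K (x : nat -> bool) a : 0 < a ->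
  exists b : bool, \sum_(i < 2 ^ K) x (logn 2 (a + i)) = prefix_value K x + b.
Proof.
elim: K x a => [|K IH] x a a0.
  by exists (x (logn 2 a)); rewrite expn0 big_ord1 addn0.
(* The window is cut into pairs of consecutive numbers: the odd one contributes [x 0], and halving
   the even one leads to the shifted sequence. *)
have pairs (f : nat -> nat) m :
    \sum_(i < m.*2) f i = \sum_(j < m) (f j.*2 + f j.*2.+1).
  by elim: m => [|m IHm]; rewrite ?big_ord0 // !big_ord_recr /= IHm addnA.
have [b bE] := IH (x \o succn) (uphalf a) ltac:(rewrite uphalf_gt0 //).
have odd_logn n : odd n -> logn 2 n = 0.
  by move=> on; apply/eqP; rewrite -leqn0 leqNgt logn_gt0 mem_primes dvdn2 on !andbF.
have even_logn n : 0 < n -> logn 2 n.*2 = (logn 2 n).+1.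
  by move=> n0; rewrite -mul2n lognM.
exists b; rewrite expnS mul2n (pairs (fun i => x (logn 2 (a + i)) : nat)) /=.
transitivity (\sum_(j < 2 ^ K) (x 0 + (x \o succn) (logn 2 (uphalf a + j)))).
  apply: eq_bigr => j _ /=; have [oa|ea] := boolP (odd a).
    rewrite odd_logn ?oddD ?oa ?odd_double // -even_logn ?addn_gt0 ?uphalf_gt0 ?a0 //.
    by congr (_ + x (logn 2 _)); lia.
  rewrite addnC odd_logn ?oddD ?(negbTE ea) /= ?odd_double //.
  by rewrite -even_logn ?addn_gt0 ?uphalf_gt0 ?a0 //; congr (_ + x (logn 2 _)); lia.
by rewrite big_split /= sum_nat_const card_ord bE mulnC addnA.
Qed.

Definition interleave (x : nat -> bool) (i : nat) : bool := ~~ odd i && x i./2.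

(* Interleaving with zeros makes the prefix values of distinct sequences
   eventually differ by at least 2, more than the error in [sum_ruler]. *)
Lemma sum_ruler_separated x y : x <> y -> exists K, forall a b, 0 < a -> 0 < b ->
  \sum_(i < 2 ^ K) interleave x (logn 2 (a + i)) !=
  \sum_(i < 2 ^ K) interleave y (logn 2 (b + i)).
Proof.
move=> xy; have ne : exists i, x i != y i.
  apply: contrapT => h; apply: xy; apply/funext => i; apply: contrapT => xy.
  by apply: h; exists i; apply/eqP.
have [i xyi imin] := ex_minnP ne.
(* The first [i.*2] digits agree, the next differs and the last is zero: the prefix values differ by
   exactly 2, and the errors [u], [v] by at most 1. *)
exists i.*2.+2 => a b a0 b0; have [u ->] := sum_ruler i.*2.+2 (interleave x) a0.
have [v ->] := sum_ruler i.*2.+2 (interleave y) b0.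
rewrite !prefix_valueSr (@eq_prefix_value i.*2 (interleave x) (interleave y)).
  rewrite /interleave /= odd_double /= doubleK.
  by move: xyi; case: (x i) (y i) u v => [] [] [] []; lia.
move=> j ji; rewrite /interleave; have [//|oj] := boolP (odd j); congr (_ && _).
apply: contrapT => /eqP /imin; lia.
Qed.

Definition word (x : nat -> bool) (n : nat) : bool := interleave x (logn 2 n.+1).

(** The count of peaks with three predecessors depends on [G] and the path but not on [x], so two
    words can be compared through it. *)
Lemma peaks_word (x : nat -> bool) (G : frame) (V : nat -> set G) N m e
    (g : nat -> G) i0 :
  differentiated V -> transfers V (comb_frame (word x)) -> straight m e g ->
  0 < N -> 1 < i0 -> i0 + N.*2 <= m -> e i0.-1 ->
  exists2 a, 0 < a &
    \sum_(j < N) `[< three_below (g (i0 + j.*2)) >] =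
    \sum_(j < N) interleave x (logn 2 (a + j)).
Proof.
move=> dV VF sg N0 i1 im ei; have [k [ko kmono kw]] := straight_lift dV VF sg.
have oi : odd (k i0) by rewrite ko //; lia.
case: kmono => kE.
  have kj j : j < N -> k (i0 + j.*2) = k i0 + j.*2.
    by move=> jN; rewrite (kE (i0 + j.*2)) ?(kE i0); lia.
  exists (k i0)./2.+1 => //; apply: eq_bigr => j _; congr nat_of_bool.
  have E := kj j (ltn_ord j).
  have -> : interleave x (logn 2 ((k i0)./2.+1 + j)) = word x (k (i0 + j.*2))./2.
    by rewrite /word E; congr (interleave x (logn 2 _)); lia.
  have [] := kw (i0 + j.*2); [lia|have := ltn_ord j; lia|
    by rewrite E oddD oi odd_double|].
  by move=> h1 h2; apply/asboolP/idP.
have kj j : j < N -> k (i0 + j.*2) + j.*2 = k i0.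
  by move=> jN; have := kE (i0 + j.*2) ltac:(lia); have := kE i0 ltac:(lia); lia.
have kN := kj N.-1 ltac:(lia).
(* On a leftward path the window starts at the last peak and is read backwards; the outer successor
   is the shift in [word]. *)
exists ((k i0)./2 - N.-1).+1 => //.
rewrite [RHS](reindex_inj rev_ord_inj); apply: eq_bigr => j _; congr nat_of_bool.
have E := kj j (ltn_ord j); have jN := ltn_ord j.
have -> : interleave x (logn 2 (((k i0)./2 - N.-1).+1 + rev_ord j)) =
    word x (k (i0 + j.*2))./2.
  by rewrite /word; congr (interleave x (logn 2 _)); rewrite /=; lia.
have [] := kw (i0 + j.*2); [lia|lia|by move: oi; rewrite -E oddD odd_double addbF|].
by move=> h1 h2; apply/asboolP/idP.
Qed.

Lemma logic_of_comb_separated x y (L : set form) :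
  normal_tense_logic L -> logic_of (comb_frame (word x)) `<=` L ->
  logic_of (comb_frame (word y)) `<=` L -> (forall n, ~ L (bz n)) -> x = y.
Proof.
move=> nL xL yL nbz; apply: contrapT => /sum_ruler_separated[K Kxy].
have cL : consistent L.
  move=> LB; apply: (nbz 0); apply: (ntl_mp nL) LB.
  by apply: (ntl_taut nL); taut.
have [G [V [dV LV]]] := canonical_model nL cL.
(* The [2 ^ K] peaks take [(2 ^ K).*2] steps, and the first one used has index 2 or 3. *)
have [m mE] : exists m, m = (2 ^ K).*2 + 3 by exists ((2 ^ K).*2 + 3).
have [c ncV] : exists c : G, ~ sat V c (bz m.-1).
  by apply/existsNP => h; apply: (nbz m.-1); apply/LV.
have /not_implyP[cm ncm] : ~ (sat V c (iter m Delta (Var 0)) ->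
  sat V c (iter m.-1 Delta (Var 0))).
  by rewrite (_ : m = m.-1.+1); [exact: ncV|lia].
have [v cv v0] := (sat_iter_Delta V m c (Var 0)).1 cm.
have ncv n : n < m -> ~ reach n c v.
  move=> nm cnv; apply: ncm; apply/sat_iter_Delta; exists v => //.
  by apply: reach_mono cnv; lia.
have [g [g0 gm gn]] := reach_path cv.
have gr := path_reach gn.
(* A repetition on the path could be cut out, bringing [v] within fewer than [m] steps of [c]. *)
have short i d : i + d.+1 <= m -> g i <> g (i + d.+1).
  move=> im E; apply: (ncv (m - d.+1)); first lia.
  have := gr 0 i ltac:(lia); rewrite add0n g0 E => c1.
  have := gr (i + d.+1) (m - (i + d.+1)) ltac:(lia); rewrite subnKC // gm => c2.
  by have := reach_add c1 c2; congr reach; lia.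
pose e i := `[< acc (g i) (g i.+1) >].
have sg : straight m e g.
  split=> i im; last 2 first.
  - by have := short i 0; rewrite addn1; exact.
  - by have := short i 1; rewrite addn2; exact.
  rewrite /step /e; case: asboolP => // na.
  by have [E|//|//] := gn i im; case: (short i 0 ltac:(lia)); rewrite addn1.
have xV := model_transfers (fun a => (LV a).1) xL.
have yV := model_transfers (fun a => (LV a).1) yL.
have N0 : 0 < 2 ^ K by rewrite expn_gt0.
(* Directions alternate inside the path, as the lift to one comb shows. The index [i0] is a
   condition on [e] alone and so serves both words. *)
have [i0 [i1 im ei]] : exists i0, [/\ 1 < i0, i0 + (2 ^ K).*2 <= m & e i0.-1].
  have [k [ko kmono _]] := straight_lift dV xV sg.
  have k2 := ko 2 ltac:(lia); have k3 := ko 3 ltac:(lia).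
  have [e1|ne1] := boolP (e 1); first by exists 2; split=> //; lia.
  exists 3; split=> //; first lia.
  rewrite -k3; rewrite -k2 in ne1.
  by case: kmono => kE; have := kE 2 ltac:(lia); have := kE 3 ltac:(lia); lia.
have [a a0 aE] := peaks_word dV xV sg N0 i1 im ei.
have [b b0 bE] := peaks_word dV yV sg N0 i1 im ei.
by have /eqP := Kxy a b a0 b0; apply; rewrite -aE -bE.
Qed.

(** * Pretabular logics *)

(** Every walk shortens to one without repetitions, whose length is bounded by the number of
    points. *)
Lemma logic_of_finite_bz (F : frame) :
  finite_set [set: F] -> exists n, logic_of F (bz n).
Proof.
move=> /finite_seqP[s sE]; exists (size s).
have sF (p : F) : p \in s by have : [set: F] p by []; rewrite sE.
pose nb (p q : F) := `[< near p q >].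
have short n (p q : F) : reach n p q -> reach (size s) p q.
  move=> /reach_path[g [g0 gn gi]].
  have pth : path nb p (mkseq (fun i => g i.+1) n) /\
      last p (mkseq (fun i => g i.+1) n) = q.
    rewrite -g0 -gn {g0 gn}; elim: n gi => [//|n IH] gi.
    have [IH1 IH2] := IH (fun i im => gi i (leqW im)).
    rewrite mkseqS rcons_path last_rcons IH1 IH2; split=> //.
    by apply/asboolP/gi.
  have [pth1 pth2] := pth; move: pth2; case: (shortenP pth1) => t tP tU _ tq.
  have ts : size t <= size s.
    by apply: leq_trans (uniq_leq_size (s2 := s) tU _) => [|r _] //=.
  apply: reach_mono ts _; move: tP; rewrite -tq; clear.
  elim: t p => [|r t IH] p //= /andP[/asboolP pr /IH rt]; by exists r.
move=> V p; rewrite /bz => h.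
have /(sat_iter_Delta V (size s).+1)[q pq qV] := h.
by apply/sat_iter_Delta; exists q => //; exact: short pq.
Qed.

Lemma pretabular_comb_extension x : exists L : set form,
  [/\ normal_tense_logic L, logic_of (comb_frame (word x)) `<=` L,
      pretabular L & forall n, ~ L (bz n)].
Proof.
have [||L [FL [nL nbz] Lmax]] := @Zorn_above form
    [set L | normal_tense_logic L /\ forall n, ~ L (bz n)]
    (logic_of (comb_frame (word x))).
- by split; [exact: logic_of_normal|exact: comb_not_bz].
- move=> C [A CA] CP Ctot; split; last by move=> n [B /CP[_ +]]; apply.
  split=> [a ta|a b [B CB Bab] [B' CB' Ba]|s a [B CB Ba]|a b].
  + by exists A => //; apply: ntl_taut ta; exact: (CP _ CA).1.
  + have [BB'|BB'] := Ctot _ _ CB CB'.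
      by exists B' => //; apply: (ntl_mp (CP _ CB').1) Ba; exact: BB'.
    by exists B => //; apply: (ntl_mp (CP _ CB).1) Bab _; exact: BB'.
  + by exists B => //; apply: (ntl_subst (CP _ CB).1).
  + by split=> -[B CB Bab]; exists B => //; apply/(ntl_adjoint (CP _ CB).1).
exists L; split=> //; split.
  (* A finite frame would put some [bz n] into [L], so [L] is not tabular. *)
  move=> [F /logic_of_finite_bz[n Fn] LE].
  by apply: (nbz n); rewrite LE.
move=> L' nL' LL' cL'; have [n Ln] : exists n, L' (bz n).
  apply: contrapT => h; apply: (Lmax _ LL'); split=> // n Ln.
  by apply: h; exists n.
apply: (tabular_bz nL' cL' (@comb_near_bounded (word x)) _ Ln).
exact: subset_trans FL LL'.1.
Qed.

Lemma PTAB_sub (L L' : set form) : L `<=` L' -> PTAB L' `<=` PTAB L.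
Proof. by move=> LL' M [nM LM pM]; split=> //; exact: subset_trans LM. Qed.

Theorem theorem8p22 :
  (PTAB S4t #>= PTAB (S4BP (Fin 2) Omega (Fin 2) (Fin 3))) /\
  (PTAB (S4BP (Fin 2) Omega (Fin 2) (Fin 3)) #= [set: nat -> bool]).
Proof.
split.
  apply: subset_card_le; apply: PTAB_sub.
  by apply: sub_smallest; exact: subsetUl.
rewrite card_eq_le; apply/andP; split.
  (* Upper bound: a logic is determined by its characteristic function on the codes of formulas. *)
  apply/pcard_injP; exists (fun L n =>
    if unpickle n is Some a then `[< L a >] else false).
  move=> L L' _ _ LL'; apply/seteqP; split=> a La;
    have := congr1 (@^~ (pickle a)) LL'; rewrite pickleK => aE; apply/asboolP.
    by rewrite -aE; apply/asboolP.
  by rewrite aE; apply/asboolP.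
have /choice[M MP] := pretabular_comb_extension.
have MI : {in [set: nat -> bool] &, injective M}.
  move=> x y _ _ Mxy; have [nL xL _ nbz] := MP x; have [_ yL _ _] := MP y.
  by apply: (logic_of_comb_separated nL xL _ nbz); rewrite Mxy.
apply: card_le_trans (subset_card_le (A := M @` setT) _); last first.
  move=> _ [x _ <-]; have [nL xL pL _] := MP x; split=> //.
  by apply: subset_trans xL; exact: comb_S4BP.
by have := inj_card_eq MI; rewrite card_eq_le => /andP[].
Qed.
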